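(* (NC-Euler formula) Let $Q$ be a quiver, $p$ a path in $Q$ and $a$ an arrow of $Q$. Then $$\mu\circ\left(a\frac{\partial}{\partial a}\right)(p) = \deg_a(p)\,p.$$ Whence $$\sum_{a\in Q_1} \mu\circ \left(a\frac{\partial}{\partial a}\right)(p) = |p|\,p,$$ with $|p|$ the length of $p$.
   Context: $\mathbb{C}$ is an algebraically closed field of characteristic $0$; $Q$ is a finite quiver with arrows $Q_1$; $t(a)$, $h(a)$ are tail and head; paths in the path algebra $A=\mathbb{C}Q$ are multiplied so that $a=e_{t(a)}ae_{h(a)}$, i.e. a path is written $a_1a_2\cdots a_n$ with $h(a_i)=t(a_{i+1})$. The double derivation $\frac{\partial}{\partial a}:A\to A\otimes A$ is the derivation for the outer bimodule structure $b(a'\otimes a'')c=ba'\otimes a''c$, vanishing on vertex idempotents, with $\frac{\partial}{\partial a}(a)=e_{t(a)}\otimes e_{h(a)}$ and $\frac{\partial}{\partial a}(b)=0$ for arrows $b\neq a$. In Sweedler notation $\frac{\partial}{\partial a}(p)=\sum\frac{\partial p}{\partial a}'\otimes\frac{\partial p}{\partial a}''$, and $a\frac{\partial}{\partial a}$ is defined by the inner multiplication: $\left(a\frac{\partial}{\partial a}\right)(p)=\sum\frac{\partial p}{\partial a}'\otimes a\frac{\partial p}{\partial a}''$. $\mu:A\otimes A\to A$ is the multiplication and $\deg_a(p)$ is the number of occurrences of $a$ in $p$. *)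

(* Defs.v *)
From HB Require Import structures.
From mathcomp Require Import all_boot all_algebra.
From mathcomp Require Import finmap monalg.

Set Implicit Arguments.
Unset Strict Implicit.
Unset Printing Implicit Defensive.

Import GRing.Theory.

Local Open Scope fset_scope.
Local Open Scope ring_scope.

(* {malg R[K]} is used here only as the free R-module on the basis K. *)

(* linext and path_elt are locked so that conversion never has to compare
   finitely supported functions. *)
HB.lock Definition linext (R : comNzRingType) (K : choiceType) (U : lmodType R)
    (f : K -> U) (g : {malg R[K]}) : U :=
  \sum_(k <- msupp g) g@_k *: f k.

Section LinearExtension.
Context {R : comNzRingType} {K : choiceType} {U : lmodType R}.
Implicit Types (f : K -> U) (g : {malg R[K]}).

Lemma linextEw f g (d : {fset K}) :
  msupp g `<=` d -> linext f g = \sum_(k <- d) g@_k *: f k.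
Proof.
move=> le; rewrite unlock.
apply: big_fset_incl => // k _ /mcoeff_outdom ->; exact: scale0r.
Qed.

Lemma linextP f c g1 g2 :
  linext f (c *: g1 + g2) = c *: linext f g1 + linext f g2.
Proof.
pose d := msupp g1 `|` msupp g2 `|` msupp (c *: g1 + g2).
have l1 : msupp g1 `<=` d by rewrite /d -fsetUA fsubsetUl.
have l2 : msupp g2 `<=` d by rewrite /d fsetUAC fsubsetUr.
have l3 : msupp (c *: g1 + g2) `<=` d by rewrite /d fsubsetUr.
rewrite (linextEw _ l1) (linextEw _ l2) (linextEw _ l3).
rewrite scaler_sumr -big_split /=; apply: eq_bigr => k _.
by rewrite mcoeffD mcoeffZ scalerDl scalerA.
Qed.

HB.instance Definition _ f :=
  GRing.isLinear.Build R {malg R[K]} U _ (linext f) (linextP f).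

Lemma linextU f k : linext f << k >> = f k.
Proof.
rewrite (@linextEw _ _ [fset k]) ?msuppU_le //.
by rewrite big_seq_fset1 mcoeffUU scale1r.
Qed.

Lemma linext_sub f1 f2 c g :
  linext (fun k => c *: f1 k + f2 k) g = c *: linext f1 g + linext f2 g.
Proof.
rewrite unlock scaler_sumr -big_split /=; apply: eq_bigr => k _.
by rewrite scalerDr !scalerA mulrC.
Qed.

Lemma malg_basis g : g = \sum_(k <- msupp g) g@_k *: << k >>.
Proof.
rewrite {1}[g]monalgE; apply: eq_bigr => k _.
by apply/malgP=> k'; rewrite mcoeffZ !mcoeffU mulr_natr.
Qed.

Lemma malg_lin_ext (F G : {malg R[K]} -> U) :
  linear F -> linear G -> (forall k, F << k >> = G << k >>) -> F =1 G.
Proof.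
move=> linF linG eqFG g.
pose F' : {linear {malg R[K]} -> U} :=
  HB.pack F (GRing.isLinear.Build R {malg R[K]} U _ F linF).
pose G' : {linear {malg R[K]} -> U} :=
  HB.pack G (GRing.isLinear.Build R {malg R[K]} U _ G linG).
rewrite (malg_basis g) -[F _]/(F' _) -[G _]/(G' _) !linear_sum.
by apply: eq_bigr => k _; rewrite !linearZ /= eqFG.
Qed.

End LinearExtension.

Lemma eq_linext (R : comNzRingType) (K : choiceType) (U : lmodType R)
  (f1 f2 : K -> U) : f1 =1 f2 -> linext f1 =1 linext f2.
Proof. by move=> e g; rewrite unlock; apply: eq_bigr => k _; rewrite e. Qed.

(* The tensor product of the free modules on I and J is the free module on
   I * J; tensor_lift_tensor and tensor_lift_unique give its universal
   property. *)

Lemma scaler_exchange (R : comNzRingType) (U : lmodType R) (k l : R)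
    (x1 x2 y1 y2 : U) :
  k *: (l *: x1 + y1) + (l *: x2 + y2) = l *: (k *: x1 + x2) + (k *: y1 + y2).
Proof. by rewrite !scalerDr !scalerA mulrC addrACA. Qed.

Section Tensor.
Context {R : comNzRingType} {I J : choiceType}.

Definition tensor_type : Type := {malg R[(I * J)%type]}.
HB.instance Definition _ := GRing.Lmodule.on tensor_type.

Definition tensor (x : {malg R[I]}) (y : {malg R[J]}) : tensor_type :=
  linext (fun i => linext (fun j => << (i, j) >> : tensor_type) y) x.

Definition tensor_lift (U : lmodType R) (f : {malg R[I]} -> {malg R[J]} -> U)
  (t : tensor_type) : U := linext (fun ij => f << ij.1 >> << ij.2 >>) t.

Lemma tensorPl c x1 x2 y :
  tensor (c *: x1 + x2) y = c *: tensor x1 y + tensor x2 y.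
Proof. exact: linextP. Qed.

Lemma tensorPr x c y1 y2 :
  tensor x (c *: y1 + y2) = c *: tensor x y1 + tensor x y2.
Proof.
by rewrite -linext_sub; apply: eq_linext => i; rewrite linextP.
Qed.

Lemma tensorU i j : tensor << i >> << j >> = << (i, j) >>.
Proof. by rewrite /tensor !linextU. Qed.

Lemma tensor_liftP (U : lmodType R) (f : {malg R[I]} -> {malg R[J]} -> U)
    c t1 t2 :
  tensor_lift f (c *: t1 + t2) = c *: tensor_lift f t1 + tensor_lift f t2.
Proof. exact: linextP. Qed.

HB.instance Definition _ (U : lmodType R) (f : {malg R[I]} -> {malg R[J]} -> U)
  := GRing.isLinear.Build R tensor_type U _ (tensor_lift f) (tensor_liftP f).

Lemma tensor_lift_tensor (U : lmodType R) (f : {malg R[I]} -> {malg R[J]} -> U) :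
  (forall y, linear (f^~ y)) -> (forall x, linear (f x)) ->
  forall x y, tensor_lift f (tensor x y) = f x y.
Proof.
move=> linl linr x y.
pose F x := tensor_lift f (tensor x y).
apply: (@malg_lin_ext _ _ _ F (f^~ y)) => [c u v||i].
- by rewrite /F tensorPl tensor_liftP.
- exact: linl.
pose G y := tensor_lift f (tensor << i >> y).
apply: (@malg_lin_ext _ _ _ G (f << i >>)) => [c u v||j].
- by rewrite /G tensorPr tensor_liftP.
- exact: linr.
by rewrite /G tensorU /tensor_lift linextU.
Qed.

Lemma tensor_lift_unique (U : lmodType R) (F G : tensor_type -> U) :
  linear F -> linear G ->
  (forall x y, F (tensor x y) = G (tensor x y)) -> F =1 G.
Proof.
move=> linF linG e; apply: (@malg_lin_ext _ _ _ F G) => // -[i j].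
by rewrite -tensorU e.
Qed.

End Tensor.
Arguments tensor_type : clear implicits.

Notation "x ⊗ y" := (tensor x y) (at level 40, left associativity) : ring_scope.

Record quiver := Quiver {
  vertex : finType;
  arrow : finType;
  tl : arrow -> vertex;
  hd : arrow -> vertex
}.

Section Paths.
Variable Q : quiver.
Implicit Types (v : vertex Q) (s : seq (arrow Q)).

Fixpoint walk v s : bool :=
  if s is a :: s' then (tl a == v) && walk (hd a) s' else true.

Definition walk_end v s : vertex Q := last v [seq hd a | a <- s].

Lemma walk_cat v s1 s2 :
  walk v (s1 ++ s2) = walk v s1 && walk (walk_end v s1) s2.
Proof. by elim: s1 v => //= a s1 IH v; rewrite IH andbA. Qed.

Lemma walk_end_cat v s1 s2 :
  walk_end v (s1 ++ s2) = walk_end (walk_end v s1) s2.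
Proof. by rewrite /walk_end map_cat last_cat. Qed.

(* A path is its starting vertex together with its sequence of arrows, so that
   (v, [::]) is the trivial path at v. *)
Record qpath := QPath {
  path_data : vertex Q * seq (arrow Q);
  path_walk : walk path_data.1 path_data.2
}.

HB.instance Definition _ := [isSub for path_data].
HB.instance Definition _ := [Choice of qpath by <:].

Definition path_src (p : qpath) : vertex Q := (path_data p).1.
Definition path_arrows (p : qpath) : seq (arrow Q) := (path_data p).2.
Definition path_tgt (p : qpath) : vertex Q :=
  walk_end (path_src p) (path_arrows p).

Definition path_length (p : qpath) : nat := size (path_arrows p).
Definition path_deg (a : arrow Q) (p : qpath) : nat :=
  count_mem a (path_arrows p).

Definition trivial_path v : qpath := @QPath (v, [::]) isT.

Lemma arrow_walk (a : arrow Q) : walk (tl a) [:: a].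
Proof. by rewrite /= eqxx. Qed.
Definition arrow_path (a : arrow Q) : qpath :=
  @QPath (tl a, [:: a]) (arrow_walk a).

Lemma path_cat_walk (p q : qpath) : path_tgt p == path_src q ->
  walk (path_src p) (path_arrows p ++ path_arrows q).
Proof.
by move=> /eqP e; rewrite walk_cat (path_walk p) [walk_end _ _]e (path_walk q).
Qed.
Definition path_cat (p q : qpath) (pq : path_tgt p == path_src q) : qpath :=
  @QPath (path_src p, path_arrows p ++ path_arrows q) (path_cat_walk pq).

End Paths.

Definition path_algebra (R : comNzRingType) (Q : quiver) : Type :=
  {malg R[qpath Q]}.
HB.instance Definition _ R Q := GRing.Lmodule.on (path_algebra R Q).

HB.lock Definition path_elt (R : comNzRingType) (Q : quiver) (p : qpath Q) :
  path_algebra R Q := << p >>.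
Arguments path_elt R {Q} p.

Section PathAlgebra.
Variables (R : comNzRingType) (Q : quiver).
Local Notation path_algebra := (path_algebra R Q).
Local Notation path_elt := (path_elt R).

Definition idem (v : vertex Q) : path_algebra := path_elt (trivial_path v).
Definition arrow_elt (a : arrow Q) : path_algebra := path_elt (arrow_path a).

Definition path_mul (p q : qpath Q) : path_algebra :=
  if @idP (path_tgt p == path_src q) is ReflectT pq
  then path_elt (path_cat pq) else 0.

Definition pa_mul (x y : path_algebra) : path_algebra :=
  linext (fun p => linext (path_mul p) y) x.
Definition pa_one : path_algebra := \sum_(v : vertex Q) idem v.

Lemma pa_mulPl c x1 x2 y :
  pa_mul (c *: x1 + x2) y = c *: pa_mul x1 y + pa_mul x2 y.
Proof. exact: linextP. Qed.

Lemma pa_mulPr x c y1 y2 :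
  pa_mul x (c *: y1 + y2) = c *: pa_mul x y1 + pa_mul x y2.
Proof.
rewrite /pa_mul; apply: etrans (linext_sub _ _ _ _).
by apply: eq_linext => p; apply: linextP.
Qed.

Lemma pa_mul_addl : left_distributive pa_mul +%R.
Proof. by move=> x y z; have := pa_mulPl 1 x y z; rewrite !scale1r. Qed.
Lemma pa_mul_addr : right_distributive pa_mul +%R.
Proof. by move=> x y z; have := pa_mulPr x 1 y z; rewrite !scale1r. Qed.
Lemma pa_mul0l x : pa_mul 0 x = 0.
Proof. by rewrite /pa_mul linear0. Qed.
Lemma pa_mul0r x : pa_mul x 0 = 0.
Proof. by have /esym/eqP := pa_mul_addr x 0 0; rewrite addr0 -[X in _ == X]addr0 (inj_eq (addrI _)) => /eqP. Qed.

Lemma pa_mulZl c x y : pa_mul (c *: x) y = c *: pa_mul x y.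
Proof. exact: linearZ. Qed.

Lemma pa_mulZr x c y : pa_mul x (c *: y) = c *: pa_mul x y.
Proof.
have := pa_mulPr x c y 0; rewrite pa_mul0r.
by rewrite [X in pa_mul x X]addr0 [X in _ = X]addr0.
Qed.

Lemma pa_mulU p q : pa_mul (path_elt p) (path_elt q) = path_mul p q.
Proof. by rewrite /pa_mul !path_elt.unlock !linextU. Qed.

(* path_word v s is the class of the walk s from v, and 0 if s is not one. *)
Definition path_word (v : vertex Q) (s : seq (arrow Q)) : path_algebra :=
  if @insub _ (fun d => walk d.1 d.2) (qpath Q) (v, s) is Some p
  then path_elt p else 0.

Lemma path_wordE p : path_elt p = path_word (path_src p) (path_arrows p).
Proof.
by rewrite /path_word -surjective_pairing (valK p : insub (path_data p) = _).
Qed.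

Lemma path_mulE v s w t : walk v s -> walk w t ->
  pa_mul (path_word v s) (path_word w t) =
  if walk_end v s == w then path_word v (s ++ t) else 0.
Proof.
move=> ws wt; pose p := QPath (path_data := (v, s)) ws.
pose q := QPath (path_data := (w, t)) wt.
rewrite -[path_word v s](path_wordE p) -[path_word w t](path_wordE q) pa_mulU.
rewrite /path_mul; case: {-}_ / idP => [pq|/negP/negbTE pq].
  by rewrite path_wordE /= [_ == _]pq.
by rewrite [_ == _]pq.
Qed.

Lemma pa_lin_ext (U : lmodType R) (F G : path_algebra -> U) :
  linear F -> linear G ->
  (forall v s, walk v s -> F (path_word v s) = G (path_word v s)) -> F =1 G.
Proof.
move=> linF linG e; apply: (@malg_lin_ext _ _ _ F G) => // p.
have -> : << p >> = path_elt p by rewrite path_elt.unlock.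
by rewrite path_wordE; apply/e/path_walk.
Qed.

Lemma pa_mulA : associative pa_mul.
Proof.
move=> x y z; move: x; apply: pa_lin_ext => [c ? ?|c ? ?|v s ws].
- by rewrite pa_mulPl.
- by rewrite !pa_mulPl.
move: y; apply: pa_lin_ext => [c ? ?|c ? ?|w t wt].
- by rewrite pa_mulPl pa_mulPr.
- by rewrite pa_mulPr pa_mulPl.
move: z; apply: pa_lin_ext => [c ? ?|c ? ?|u r wr].
- by rewrite !pa_mulPr.
- by rewrite !pa_mulPr.
rewrite (path_mulE ws wt) (path_mulE wt wr).
case: (eqVneq (walk_end v s) w) => [ew|nw]; last first.
  rewrite pa_mul0l; case: (eqVneq (walk_end w t) u) => er.
    rewrite path_mulE ?(negbTE nw) // walk_cat wt er; exact: wr.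
  by rewrite pa_mul0r.
have wst : walk v (s ++ t) by rewrite walk_cat ws ew.
rewrite (path_mulE wst wr) walk_end_cat ew.
case: (eqVneq (walk_end w t) u) => er; last by rewrite pa_mul0r.
have wtr : walk w (t ++ r) by rewrite walk_cat wt er.
by rewrite (path_mulE ws wtr) ew eqxx catA.
Qed.

Lemma idemE v : idem v = path_word v [::].
Proof. exact: path_wordE. Qed.

Lemma arrow_eltE a : arrow_elt a = path_word (tl a) [:: a].
Proof. exact: path_wordE. Qed.

Lemma pa_mul1 : left_id pa_one pa_mul.
Proof.
apply: pa_lin_ext => [c x y|c x y|v s ws]; first exact: pa_mulPr.
  by [].
pose F x := pa_mul x (path_word v s).
have F0 : F 0 = 0 by exact: pa_mul0l.
have FD : {morph F : x y / x + y} by move=> x y; exact: pa_mul_addl.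
rewrite -[LHS]/(F _) /pa_one (big_morph F FD F0) (bigD1 v) //= big1 => [|w nw].
  by rewrite addr0 /F idemE path_mulE //= eqxx.
by rewrite /F idemE path_mulE //= (negbTE nw).
Qed.

Lemma pa_mul_1 : right_id pa_one pa_mul.
Proof.
apply: pa_lin_ext => [c x y|c x y|v s ws]; first exact: pa_mulPl.
  by [].
pose F x := pa_mul (path_word v s) x.
have F0 : F 0 = 0 by exact: pa_mul0r.
have FD : {morph F : x y / x + y} by move=> x y; exact: pa_mul_addr.
rewrite -[LHS]/(F _) /pa_one (big_morph F FD F0) (bigD1 (walk_end v s)) //=.
rewrite big1 => [|w nw].
  by rewrite addr0 /F idemE path_mulE //= eqxx cats0.
by rewrite /F idemE path_mulE //= eq_sym (negbTE nw).
Qed.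

HB.instance Definition _ := GRing.Zmodule_isPzRing.Build path_algebra
  pa_mulA pa_mul1 pa_mul_1 pa_mul_addl pa_mul_addr.

(* path_algebra is not declared an lalgType: that structure requires 1 != 0,
   which fails for the empty quiver. *)
Lemma pa_scaleAl (c : R) (x y : path_algebra) : c *: (x * y) = (c *: x) * y.
Proof. exact/esym/pa_mulZl. Qed.

Lemma pa_scaleAr (c : R) (x y : path_algebra) : c *: (x * y) = x * (c *: y).
Proof. exact/esym/pa_mulZr. Qed.

Lemma mulPl (c : R) (x1 x2 y : path_algebra) :
  (c *: x1 + x2) * y = c *: (x1 * y) + x2 * y.
Proof. exact: pa_mulPl. Qed.

Lemma mulPr (c : R) (x y1 y2 : path_algebra) :
  x * (c *: y1 + y2) = c *: (x * y1) + x * y2.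
Proof. exact: pa_mulPr. Qed.

Lemma word_mulE v s w t : walk v s -> walk w t ->
  path_word v s * path_word w t =
  if walk_end v s == w then path_word v (s ++ t) else 0.
Proof. exact: path_mulE. Qed.

End PathAlgebra.

Arguments idem R {Q} v.
Arguments arrow_elt R {Q} a.
Arguments path_word R {Q} v s.

Section DoubleDerivative.
Variables (R : comNzRingType) (Q : quiver).
Local Notation A := (path_algebra R Q).
Local Notation AA := (tensor_type R (qpath Q) (qpath Q)).
Implicit Types (a : arrow Q) (b c x y : A) (t : AA).

(* The outer bimodule structure b (x ⊗ y) c = b x ⊗ y c; see outer_tensor. *)
Definition outer b t c : AA := tensor_lift (fun x y : A => (b * x) ⊗ (y * c)) t.

(* The inner left multiplication b (x ⊗ y) = x ⊗ b y; see inner_left_tensor. *)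
Definition inner_left b t : AA := tensor_lift (fun x y : A => x ⊗ (b * y)) t.

Definition mu t : A := tensor_lift (fun x y : A => x * y) t.

Record is_double_derivative a (D : A -> AA) : Prop := {
  dder_linear : linear D;
  dder_leibniz : forall x y, D (x * y) = outer 1 (D x) y + outer x (D y) 1;
  dder_idem : forall v, D (idem R v) = 0;
  dder_arrow : D (arrow_elt R a) = idem R (tl a) ⊗ idem R (hd a);
  dder_other : forall b : arrow Q, b != a -> D (arrow_elt R b) = 0
}.

Lemma outer_tensor b x y c : outer b (x ⊗ y) c = (b * x) ⊗ (y * c).
Proof.
rewrite /outer tensor_lift_tensor // => [z k u v|z k u v].
  by rewrite mulPr tensorPl.
by rewrite mulPl tensorPr.
Qed.

Lemma inner_left_tensor b x y : inner_left b (x ⊗ y) = x ⊗ (b * y).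
Proof.
rewrite /inner_left tensor_lift_tensor // => [z k u v|z k u v].
  by rewrite tensorPl.
by rewrite mulPr tensorPr.
Qed.

Lemma mu_tensor x y : mu (x ⊗ y) = x * y.
Proof.
rewrite /mu tensor_lift_tensor // => [z k u v|z k u v]; first exact: mulPl.
exact: mulPr.
Qed.

Lemma outerP b c k t1 t2 :
  outer b (k *: t1 + t2) c = k *: outer b t1 c + outer b t2 c.
Proof. exact: tensor_liftP. Qed.

Lemma inner_leftP b k t1 t2 :
  inner_left b (k *: t1 + t2) = k *: inner_left b t1 + inner_left b t2.
Proof. exact: tensor_liftP. Qed.

Lemma muP k t1 t2 : mu (k *: t1 + t2) = k *: mu t1 + mu t2.
Proof. exact: tensor_liftP. Qed.

Lemma outerPl b1 b2 c k t :
  outer (k *: b1 + b2) t c = k *: outer b1 t c + outer b2 t c.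
Proof.
move: t; apply: tensor_lift_unique => [l u v|l u v|x y].
- exact: outerP.
- by rewrite (outerP b1 c l u v) (outerP b2 c l u v); apply: scaler_exchange.
- by rewrite !outer_tensor mulPl tensorPl.
Qed.

Lemma outerPr b c1 c2 k t :
  outer b t (k *: c1 + c2) = k *: outer b t c1 + outer b t c2.
Proof.
move: t; apply: tensor_lift_unique => [l u v|l u v|x y].
- exact: outerP.
- by rewrite (outerP b c1 l u v) (outerP b c2 l u v); apply: scaler_exchange.
- by rewrite !outer_tensor mulPr tensorPr.
Qed.

Lemma outerA b1 b2 c1 c2 t :
  outer b1 (outer b2 t c1) c2 = outer (b1 * b2) t (c1 * c2).
Proof.
move: t; apply: tensor_lift_unique => [l u v|l u v|x y].
- by rewrite !outerP.
- exact: outerP.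
- by rewrite !outer_tensor !mulrA.
Qed.

Lemma outerD b c t1 t2 : outer b (t1 + t2) c = outer b t1 c + outer b t2 c.
Proof. by have := outerP b c 1 t1 t2; rewrite !scale1r. Qed.

Lemma outer0 b c : outer b 0 c = 0.
Proof. exact: linear0. Qed.

Lemma outer0l c t : outer 0 t c = 0.
Proof. by have := outerPl 0 0 c (-1) t; rewrite !scaleN1r !addNr. Qed.

Lemma outer0r b t : outer b t 0 = 0.
Proof. by have := outerPr b 0 0 (-1) t; rewrite !scaleN1r !addNr. Qed.

(* dder a realises the double derivative on the basis of paths: each occurrence
   of a in a path p = u a w contributes u ⊗ w. *)
Fixpoint dword a v s : AA :=
  if s is e :: s' then
    (if e == a then idem R (tl e) ⊗ path_word R (hd e) s' else 0)
    + outer (arrow_elt R e) (dword a (hd e) s') 1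
  else 0.

Definition dder a (x : A) : AA :=
  linext (fun p => dword a (path_src p) (path_arrows p)) x.

Lemma dderP a k x y : dder a (k *: x + y) = k *: dder a x + dder a y.
Proof. exact: linextP. Qed.

Lemma dderE a v s : walk v s -> dder a (path_word R v s) = dword a v s.
Proof.
move=> ws; pose p := QPath (path_data := (v, s)) ws.
by rewrite -[path_word R v s](path_wordE R p) /dder path_elt.unlock linextU.
Qed.

Lemma dword_l a v s : walk v s -> outer (idem R v) (dword a v s) 1 = dword a v s.
Proof.
case: s => [_|e s] /=; first exact: outer0.
case/andP=> /eqP <- ws.
rewrite outerD.
rewrite outerA.
rewrite mulr1.
congr (_ + outer _ _ _).
  by case: eqP => _; rewrite ?outer0 // outer_tensor mulr1 !idemE word_mulE //= eqxx.
by rewrite idemE arrow_eltE word_mulE //= eqxx.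
Qed.

Lemma dword_r a v s : walk v s ->
  outer 1 (dword a v s) (idem R (walk_end v s)) = dword a v s.
Proof.
elim: s v => [v _|e s IH v] /=; first exact: outer0.
case/andP=> /eqP <- ws; rewrite outerD outerA mul1r.
rewrite -{2}(IH _ ws) outerA mul1r mulr1; congr (_ + outer _ _ _).
  case: eqP => _; rewrite ?outer0 // outer_tensor mul1r.
  by rewrite !idemE word_mulE //= eqxx cats0.
by rewrite mulr1.
Qed.

Lemma dword_cat a v s1 s2 : walk v s1 -> walk (walk_end v s1) s2 ->
  dword a v (s1 ++ s2) =
    outer 1 (dword a v s1) (path_word R (walk_end v s1) s2)
    + outer (path_word R v s1) (dword a (walk_end v s1) s2) 1.
Proof.
elim: s1 v => [v _ /= w2|e s1 IH v /=].
  by rewrite outer0 add0r -idemE dword_l.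
case/andP=> /eqP <- w1 w2.
rewrite (IH _ w1 w2) !outerD !outerA !mul1r !mulr1 addrA.
congr (_ + _ + outer _ _ _).
  case: eqP => _; last by rewrite outer0.
  by rewrite outer_tensor mul1r word_mulE // eqxx.
by rewrite arrow_eltE word_mulE //= eqxx.
Qed.

Lemma dder_leibnizE a x y :
  dder a (x * y) = outer 1 (dder a x) y + outer x (dder a y) 1.
Proof.
move: x; apply: pa_lin_ext => [c x z|c x z|v s ws].
- by rewrite mulPl dderP.
- by rewrite dderP outerP outerPl scalerDr addrACA.
move: y; apply: pa_lin_ext => [c x z|c x z|w t wt].
- by rewrite mulPr dderP.
- by rewrite dderP outerP outerPr scalerDr addrACA.
rewrite word_mulE // (dderE a ws) (dderE a wt).
have [ew|nw] := eqVneq (walk_end v s) w.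
  rewrite -ew in wt *; rewrite dderE ?walk_cat ?ws //.
  exact: dword_cat.
have -> : dder a 0 = 0 by rewrite /dder linear0.
rewrite -(dword_r a ws) -(dword_l a wt) !outerA mul1r.
rewrite !idemE !word_mulE //= (negbTE nw).
by rewrite outer0l outer0r addr0.
Qed.

Lemma dder_is_double_derivative a : is_double_derivative a (dder a).
Proof.
split=> [c x y|x y|v||b /negbTE nba].
- exact: dderP.
- exact: dder_leibnizE.
- by rewrite idemE dderE.
- by rewrite arrow_eltE dderE /= ?eqxx // outer0 addr0 !idemE.
- by rewrite arrow_eltE dderE /= ?eqxx // nba outer0 addr0.
Qed.

Lemma double_derivative_exists a :
  {D : path_algebra R Q -> AA | is_double_derivative a D}.
Proof. by exists (dder a); apply: dder_is_double_derivative. Qed.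

Lemma double_derivative_unique a (D1 D2 : A -> AA) :
  is_double_derivative a D1 -> is_double_derivative a D2 -> D1 =1 D2.
Proof.
case=> l1 m1 i1 a1 o1 [l2 m2 i2 a2 o2].
apply: pa_lin_ext => // v s; elim: s v => [v _|e s IH v /=].
  by rewrite -idemE i1 i2.
case/andP=> /eqP <- ws.
have -> : path_word R (tl e) (e :: s) = arrow_elt R e * path_word R (hd e) s.
  by rewrite arrow_eltE word_mulE //= eqxx.
rewrite m1 m2 IH //; congr (outer _ _ _ + _).
by case: (eqVneq e a) => [->|ne]; [rewrite a1 a2 | rewrite o1 ?o2].
Qed.

Definition double_derivative a : A -> AA := sval (double_derivative_exists a).

Lemma double_derivativeP a : is_double_derivative a (double_derivative a).
Proof. exact: svalP. Qed.

Definition arrow_double_derivative a (x : A) : AA :=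
  inner_left (arrow_elt R a) (double_derivative a x).

End DoubleDerivative.

(* Main.v *)
Require Import Defs.
From mathcomp Require Import all_boot all_algebra.

(** The operator [euler a], the composite of multiplication with a ∂/∂a, is an
    ordinary derivation of the path algebra: inner multiplication by [a]
    followed by [mu] turns the outer bimodule structure on A ⊗ A into the
    bimodule structure of A ([mu_inner_left_outer]), so the Leibniz rule of the
    double derivative ∂/∂a becomes the Leibniz rule of [euler a]
    ([euler_leibniz]).  This derivation fixes the arrow [a] and kills all other
    arrows and all vertex idempotents; a derivation that scales each letter by a
    constant scales a word by the sum of these constants over its letters,
    which here is the number of occurrences of [a] ([euler_word]).

    Summing over all arrows, every letter of the path is counted exactly once,
    which gives the length ([sum_count_mem]). *)

Local Open Scope ring_scope.
Import GRing.Theory.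

Section Euler.
Variables (R : comNzRingType) (Q : quiver).
Local Notation A := (path_algebra R Q).
Local Notation AA := (tensor_type R (qpath Q) (qpath Q)).
Implicit Types (a e : arrow Q) (v : vertex Q) (s : seq (arrow Q)).

(** On pure tensors both sides are (b x) z (y c): the inner factor [z] and the
    outer factors [b], [c] are inserted at different places. *)
Lemma mu_inner_left_outer (z b c : A) (t : AA) :
  mu (inner_left z (outer b t c)) = b * mu (inner_left z t) * c.
Proof.
move: t; apply: tensor_lift_unique => [k u w|k u w|x y].
- by rewrite outerP inner_leftP muP.
- by rewrite inner_leftP muP mulPr mulPl.
- by rewrite outer_tensor !inner_left_tensor !mu_tensor !mulrA.
Qed.

Lemma mu_inner_leftD (z : A) (t1 t2 : AA) :
  mu (inner_left z (t1 + t2)) = mu (inner_left z t1) + mu (inner_left z t2).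
Proof. by rewrite -[t1]scale1r inner_leftP muP !scale1r. Qed.

Lemma mu_inner_left0 (z : A) : mu (inner_left z (0 : AA)) = 0.
Proof. by rewrite /inner_left linear0 /mu linear0. Qed.

Definition euler a (x : A) : A := mu (arrow_double_derivative a x).

Lemma euler_leibniz a (x y : A) :
  euler a (x * y) = euler a x * y + x * euler a y.
Proof.
rewrite /euler /arrow_double_derivative.
rewrite (dder_leibniz (double_derivativeP R a)).
by rewrite mu_inner_leftD !mu_inner_left_outer mul1r mulr1.
Qed.

Lemma euler_idem a v : euler a (idem R v) = 0.
Proof.
rewrite /euler /arrow_double_derivative (dder_idem (double_derivativeP R a)).
exact: mu_inner_left0.
Qed.

(** Here ∂/∂a (a) is the tensor of the idempotents at the two ends of [a], so
    inserting [a] between them gives back [a]. *)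
Lemma euler_arrow a e :
  euler a (arrow_elt R e) = (e == a)%:R *: arrow_elt R e.
Proof.
rewrite /euler /arrow_double_derivative.
have [->|nea] := eqVneq e a; last first.
  by rewrite (dder_other (double_derivativeP R a) nea) mu_inner_left0 scale0r.
rewrite (dder_arrow (double_derivativeP R a)) inner_left_tensor mu_tensor.
by rewrite scale1r !idemE arrow_eltE !(word_mulE, eqxx) //= ?eqxx.
Qed.

Lemma path_word_cons e s : walk (hd e) s ->
  path_word R (tl e) (e :: s) = arrow_elt R e * path_word R (hd e) s.
Proof. by move=> ws; rewrite arrow_eltE word_mulE //= eqxx. Qed.

(** In the Leibniz expansion of a word, each occurrence of [a] contributes the
    whole word once and each other letter contributes zero. *)
Lemma euler_word a v s : walk v s ->
  euler a (path_word R v s) = (count_mem a s)%:R *: path_word R v s.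
Proof.
elim: s v => [v _|e s IH v /= /andP[/eqP <- ws]].
  by rewrite -idemE euler_idem scale0r.
rewrite path_word_cons // euler_leibniz euler_arrow IH //.
by rewrite -pa_scaleAl -pa_scaleAr -scalerDl -natrD.
Qed.

Lemma euler_path a (p : qpath Q) :
  euler a (path_elt R p) = (path_deg a p)%:R *: path_elt R p.
Proof. by rewrite path_wordE; apply/euler_word/path_walk. Qed.

End Euler.

Lemma sum_count_mem (T : finType) (s : seq T) :
  (\sum_(x : T) count_mem x s)%N = size s.
Proof.
elim: s => [|y s IH] /=; first by rewrite big1.
rewrite big_split /= IH (bigD1 y) //= eqxx big1 // => x.
by rewrite eq_sym => /negbTE ->.
Qed.

Theorem proposition12 (C : closedFieldType) (charC : [pchar C] =i pred0)
    (Q : quiver) :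
  (forall (p : qpath Q) (a : arrow Q),
     mu (arrow_double_derivative a (path_elt C p))
     = (path_deg a p)%:R *: path_elt C p) /\
  (forall p : qpath Q,
     \sum_(a : arrow Q) mu (arrow_double_derivative a (path_elt C p))
     = (path_length p)%:R *: path_elt C p).
Proof.
split=> [p a|p]; first exact: euler_path.
rewrite (eq_bigr _ (fun a _ => euler_path C Q a p)).
by rewrite -scaler_suml -natr_sum sum_count_mem.
Qed.
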